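(* Consider an instance of the add-on discount revenue management problem and let $V(OPT)$ be its optimal value. Suppose $V(OPT)\ge v^*$. For any problem instance and any $\varepsilon>0$, the Discretized DP Algorithm run with parameter $$K=\left\lceil \frac{\hat p M N}{v^*\cdot\varepsilon}\right\rceil$$ outputs a $(1-\varepsilon)$-optimal policy $ALG$, i.e. $V(OPT)-V(ALG)\le\varepsilon\, V(OPT)$, with running time polynomial in both the problem size and $1/\varepsilon$. In other words, the algorithm is an FPTAS (fully polynomial-time approximation scheme).
   Context: **Problem.** There are $N$ core products and $M$ supportive products, finite sets $\Omega_c,\Omega_s,\Omega_a$ of nonnegative prices (for core products, supportive products and add-on discounts), an integer $S\ge 0$, and demand functions $\alpha_n:\Omega_c\to[0,1]$ ($n=1,\dots,N$), $\alpha_{N+m}:\Omega_s\to[0,1]$, $\beta_{N+m}:\Omega_s\to[0,1]$, $\beta'_{N+m}:\Omega_a\to[0,1]$ ($m=1,\dots,M$). A feasible policy $\pi$ specifies $p_n\in\Omega_c$ for $n=1,\dots,N$ and $p_{N+m}\in\Omega_s$, $p'_{N+m}\in\Omega_a$, $I_{N+m}\in\{0,1\}$ for $m=1,\dots,M$, with $\sum_{m=1}^M I_{N+m}\le S$ and $p'_{N+m}<p_{N+m}$ for all $m=1,\dots,M$. Its value (expected revenue per period) is $$V(\pi)=\sum_{n=1}^N\alpha_n(p_n)p_n+\sum_{m=1}^M\alpha_{N+m}(p_{N+m})p_{N+m}+\Big[\sum_{n=1}^N\alpha_n(p_n)\Big]\sum_{m=1}^M\Big[I_{N+m}\beta'_{N+m}(p'_{N+m})p'_{N+m}+(1-I_{N+m})\beta_{N+m}(p_{N+m})p_{N+m}\Big].$$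 $OPT$ is a feasible policy maximizing $V$. $\hat p:=\max_{p\in\Omega_c\cup\Omega_s}p$ is the highest price among all the products. **Discretized DP Algorithm** (input: the price sets $\Omega_c,\Omega_s,\Omega_a$, all values of the demand functions $\alpha_n,\alpha_{N+m},\beta_{N+m},\beta'_{N+m}$ on their domains, and a positive integer constant $K$). Part 1. For each $m$ and each $\gamma\in\{0,\frac1K,\frac2K,\dots,\frac{NK}{K}\}$, compute $r_{N+m}(\gamma)=\max_{p\in\Omega_s}\{\alpha_{N+m}(p)p+\gamma\beta_{N+m}(p)p\}$ and $r'_{N+m}(\gamma)=\max_{p\in\Omega_s,\,p'\in\Omega_a,\,p'<p}\{\alpha_{N+m}(p)p+\gamma\beta'_{N+m}(p')p'\}$. For each such $\gamma$, sort the numbers $r'_{N+m}(\gamma)-r_{N+m}(\gamma)$ in descending order; set $I_{N+m}(\gamma)=1$ if this difference is positive and among the first $S$ entries, and $I_{N+m}(\gamma)=0$ otherwise. Set $\mathcal R_s(\gamma)=\sum_{m=1}^M\big[r_{N+m}(\gamma)+I_{N+m}(\gamma)(r'_{N+m}(\gamma)-r_{N+m}(\gamma))\big]$. Part 2. Let $\hat\alpha_n(p)$ be $\alpha_n(p)$ rounded to the nearest integer multiple of $1/K$. Solve by backward induction $V_{N+1}(\gamma)=\mathcal R_s(\gamma)$, $V_n(\gamma)=\max_{p_n\in\Omega_c}[\alpha_n(p_n)p_n+V_{n+1}(\gamma+\hat\alpha_n(p_n))]$. The output policy $ALG$ is given by the optimal decisions retrieved along the optimality equations starting from $V_1(0)$,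 together with the supportive decisions attaining $\mathcal R_s$ at the terminal value of $\gamma$. The problem size is measured by $N,M,|\Omega_c|,|\Omega_s|,|\Omega_a|$.
   Formalization: The running time is polynomial in the problem size, 1/ε and also p̂/v*; N, M ≥ 1 and v* > 0 are assumed; ALG is fully feasible if every supportive price exceeds some discount price, otherwise p' < p is ensured only for products offered at a discount. *)

(* Defs.v *)
From mathcomp Require Import all_boot all_order all_algebra.
From mathcomp Require Import reals.
From mathcomp Require Export mpoly.

Set Implicit Arguments.
Unset Strict Implicit.
Unset Printing Implicit Defensive.

Import Order.TTheory GRing.Theory Num.Theory.
Local Open Scope ring_scope.

(* The finite price sets are duplicate-free lists, in an arbitrary order.
   Core product n is indexed by 'I_N, supportive product N+m by m : 'I_M,
   where N = nc and M = ns; the budget S of add-on discounts is [space].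
   Demand functions are constrained only on their domains. *)
Record instance (R : realType) := Instance {
  nc : nat;
  ns : nat;
  space : nat;
  Oc : seq R;
  Os : seq R;
  Oa : seq R;
  alphac : 'I_nc -> R -> R;
  alphas : 'I_ns -> R -> R;
  beta : 'I_ns -> R -> R;
  beta' : 'I_ns -> R -> R;
  Oc_uniq : uniq Oc;
  Os_uniq : uniq Os;
  Oa_uniq : uniq Oa;
  Oc_ge0 : forall p, p \in Oc -> 0 <= p;
  Os_ge0 : forall p, p \in Os -> 0 <= p;
  Oa_ge0 : forall p, p \in Oa -> 0 <= p;
  alphac01 : forall n p, p \in Oc -> 0 <= alphac n p <= 1;
  alphas01 : forall m p, p \in Os -> 0 <= alphas m p <= 1;
  beta01 : forall m p, p \in Os -> 0 <= beta m p <= 1;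
  beta'01 : forall m p, p \in Oa -> 0 <= beta' m p <= 1
}.

(* price n = p_n, sprice m = p_{N+m}, aprice m = p'_{N+m},
   chosen m = I_{N+m}. *)
Record policy (R : realType) (A : instance R) := Policy {
  price : 'I_(nc A) -> R;
  sprice : 'I_(ns A) -> R;
  aprice : 'I_(ns A) -> R;
  chosen : 'I_(ns A) -> bool
}.

Section Problem.
Variables (R : realType) (A : instance R).
Implicit Types pi : policy A.

Definition feasible pi : Prop :=
  [/\ forall n, price pi n \in Oc A,
      forall m, sprice pi m \in Os A,
      forall m, aprice pi m \in Oa A,
      (\sum_m chosen pi m <= space A)%N
    & forall m, aprice pi m < sprice pi m].

(* [feasible] with p'_{N+m} < p_{N+m} imposed only where I_{N+m} = 1, that is
   where the add-on discount is actually offered. *)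
Definition implementable pi : Prop :=
  [/\ forall n, price pi n \in Oc A,
      forall m, sprice pi m \in Os A,
      forall m, aprice pi m \in Oa A,
      (\sum_m chosen pi m <= space A)%N
    & forall m, chosen pi m -> aprice pi m < sprice pi m].

Definition value pi : R :=
  \sum_n alphac n (price pi n) * price pi n
  + \sum_m alphas m (sprice pi m) * sprice pi m
  + (\sum_n alphac n (price pi n)) *
    \sum_m ((chosen pi m)%:R * beta' m (aprice pi m) * aprice pi m
            + (1 - (chosen pi m)%:R) * beta m (sprice pi m) * sprice pi m).

Definition optimal pi : Prop :=
  feasible pi /\ forall pi', feasible pi' -> value pi' <= value pi.

(* The base 0 of the maximum is harmless: prices are nonnegative. *)
Definition top_price : R := \big[Num.max/0]_(p <- Oc A ++ Os A) p.

End Problem.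

(* [c a t]: some run of c returns a after t elementary operations.  The only
   source of nondeterminism is [geC], which may answer either way when its
   arguments are equal; hence argmax, sorting and rounding break ties in a
   completely arbitrary way.  Arithmetic operations, comparisons, queries to a
   demand function and list-cell operations each cost one unit; random access
   to a list costs as much as walking down to the cell. *)
Definition comp (T : Type) := T -> nat -> Prop.

Definition ret (T : Type) (a : T) : comp T := fun b t => b = a /\ t = 0%N.

Definition step (T : Type) (a : T) : comp T := fun b t => b = a /\ t = 1%N.

Definition bind (T U : Type) (c : comp T) (f : T -> comp U) : comp U :=
  fun b t => exists a t1 t2, [/\ c a t1, f a b t2 & t = (t1 + t2)%N].

Notation "'let*' x ':=' c 'in' f" := (bind c (fun x => f))
  (at level 200, x pattern, c at level 100, f at level 200,
   format "'[v' 'let*'  x  ':='  c  'in' '/' f ']'").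

Section Primitives.
Variable R : realType.
Implicit Types x y : R.

Definition addC x y : comp R := step (x + y).
Definition subC x y : comp R := step (x - y).
Definition mulC x y : comp R := step (x * y).
Definition divC x y : comp R := step (x / y).
Definition ltC x y : comp bool := step (x < y).

Definition geC x y : comp bool :=
  fun b t => (if b then y <= x else x <= y) /\ t = 1%N.

End Primitives.

Section Lists.
Variables T U : Type.

(* Also used as a for-loop, over a range of indices. *)
Fixpoint mapC (f : T -> comp U) (s : seq T) : comp (seq U) :=
  if s is x :: s' then
    let* y := f x in let* ys := mapC f s' in step (y :: ys)
  else step [::].

Fixpoint filterC (f : T -> comp bool) (s : seq T) : comp (seq T) :=
  if s is x :: s' then
    let* b := f x in
    let* ys := filterC f s' in
    step (if b then x :: ys else ys)
  else step [::].

Fixpoint catC (s1 s2 : seq T) : comp (seq T) :=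
  if s1 is x :: s1' then let* s := catC s1' s2 in step (x :: s) else step s2.

Fixpoint flattenC (ss : seq (seq T)) : comp (seq T) :=
  if ss is s :: ss' then let* r := flattenC ss' in catC s r else step [::].

Fixpoint nthC (x0 : T) (s : seq T) (i : nat) : comp T :=
  match s, i with
  | [::], _ => step x0
  | x :: _, 0 => step x
  | _ :: s', i'.+1 => let* _ := step tt in nthC x0 s' i'
  end.

End Lists.

Fixpoint memC (T : eqType) (x : T) (s : seq T) : comp bool :=
  if s is y :: s' then
    let* b := step (x == y) in if b then ret true else memC x s'
  else step false.

Section Keyed.
Variables (R : realType) (T : Type).
Implicit Types (x : R * T) (s : seq (R * T)).

Fixpoint sumC s : comp R :=
  if s is x :: s' then let* v := sumC s' in addC x.1 v else step 0.

Fixpoint argmax_auxC x s : comp (R * T) :=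
  if s is y :: s' then
    let* b := geC y.1 x.1 in
    if b then argmax_auxC y s' else argmax_auxC x s'
  else step x.

(* An entry (value, decision) of largest value; d is a dummy decision, used
   for the empty list only. *)
Definition argmaxC (d : T) s : comp (R * T) :=
  if s is x :: s' then argmax_auxC x s' else step (0, d).

Fixpoint insertC x s : comp (seq (R * T)) :=
  if s is y :: s' then
    let* b := geC x.1 y.1 in
    if b then step (x :: s) else let* r := insertC x s' in step (y :: r)
  else step [:: x].

(* Insertion sort, in descending order of the keys. *)
Fixpoint sortC s : comp (seq (R * T)) :=
  if s is x :: s' then let* r := sortC s' in insertC x r else step [::].

(* The decisions with a positive key among the first k entries. *)
Fixpoint selectC (k : nat) s : comp (seq T) :=
  match k, s with
  | k'.+1, x :: s' =>
      let* b := ltC 0 x.1 in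
      let* r := selectC k' s' in
      step (if b then x.2 :: r else r)
  | _, _ => step [::]
  end.

End Keyed.

Section Algorithm.
Variables (R : realType) (A : instance R) (K : nat).

(* The grid point k / K is represented by the index k. *)
Definition gridC (k : nat) : comp R := divC k%:R K%:R.

(* alpha_{N+m}(p) p + gamma beta_{N+m}(p) p, with decision p *)
Definition undiscountedC (m : 'I_(ns A)) (g p : R) : comp (R * R) :=
  let* a := step (alphas m p) in
  let* x := mulC a p in
  let* b := step (beta m p) in
  let* y := mulC b p in
  let* z := mulC g y in
  let* v := addC x z in
  ret (v, p).

(* alpha_{N+m}(p) p + gamma beta'_{N+m}(p') p', with decision (p, p') *)
Definition discountedC (m : 'I_(ns A)) (g p p' : R) : comp (R * (R * R)) :=
  let* a := step (alphas m p) in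
  let* x := mulC a p in
  let* b := step (beta' m p') in
  let* y := mulC b p' in
  let* z := mulC g y in
  let* v := addC x z in
  ret (v, (p, p')).

Definition belowC (p : R) : comp (seq R) := filterC (fun p' => ltC p' p) (Oa A).

(* r_{N+m}(gamma) with a maximizer p *)
Definition rC (m : 'I_(ns A)) (g : R) : comp (R * R) :=
  let* c := mapC (undiscountedC m g) (Os A) in
  argmaxC 0 c.

(* r'_{N+m}(gamma) with a maximizer (p, p') *)
Definition r'C (m : 'I_(ns A)) (g : R) : comp (R * (R * R)) :=
  let* cs := mapC (fun p =>
    let* s := belowC p in mapC (discountedC m g p) s) (Os A) in
  let* c := flattenC cs in
  argmaxC (0, 0) c.

(* The discount price recorded for a product which is not offered at a
   discount; it does not affect the value of the policy.  It is below p
   whenever some element of Oa is. *)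
Definition idle_priceC (p : R) : comp R :=
  let* s := belowC p in
  let* d := nthC 0 (Oa A) 0 in
  nthC d s 0.

(* R_s(gamma) at gamma = k / K, with decisions (p_{N+m}, p'_{N+m}, I_{N+m})
   listed by increasing m *)
Definition supportiveC (k : nat) : comp (R * seq (R * R * bool)) :=
  let* g := gridC k in
  let* rs := mapC (fun m : 'I_(ns A) =>
    let* r := rC m g in
    let* r' := r'C m g in
    let* d := subC r'.1 r.1 in
    ret (d, (m, r, r'))) (enum 'I_(ns A)) in
  let* keys := mapC (fun '(d, (m, _, _)) => ret (d, m)) rs in
  let* sorted := sortC keys in
  let* sel := selectC (space A) sorted in
  let* ds := mapC (fun '(d, (m, r, r')) =>
    let* i := memC m sel in
    if i then
      let* v := addC r.1 d in ret (v, (r'.2, true))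
    else
      let* p' := idle_priceC r.2 in ret (r.1, (r.2, p', false))) rs in
  let* v := sumC ds in
  let* dec := mapC (fun x => ret x.2) ds in
  ret (v, dec).

Definition part1C : comp (seq (R * seq (R * R * bool))) :=
  let* h := step (nc A * K)%N in
  mapC supportiveC (iota 0 h.+1).

(* The index j of a grid point j / K nearest to a.  Since 0 <= a <= 1, it is
   enough to search j in {0, ..., K}. *)
Definition roundC (a : R) : comp nat :=
  let* c := mapC (fun j =>
    let* g := gridC j in
    let* x := subC a g in
    let* y := step (- `|x|) in
    ret (y, j)) (iota 0 K.+1) in
  let* b := argmaxC 0%N c in
  ret b.2.

(* The entries (p, alpha_n(p) p, j) with j / K the rounding of alpha_n(p), for
   p in Oc; computed once for each n. *)
Definition roundedC (n : 'I_(nc A)) : comp (seq (R * R * nat)) :=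
  mapC (fun p =>
    let* a := step (alphac n p) in
    let* x := mulC a p in
    let* j := roundC a in
    ret (p, x, j)) (Oc A).

(* V_n(k / K), with the optimal price and the index of the next grid point,
   from the table of the values of V_{n+1} *)
Definition stageC (next : seq R) (rd : seq (R * R * nat)) (k : nat) :
    comp (R * (R * nat)) :=
  let* c := mapC (fun '(p, x, j) =>
    let* l := step (k + j)%N in
    let* w := nthC 0 next l in
    let* v := addC x w in
    ret (v, (p, l))) rd in
  argmaxC (0, 0%N) c.

(* Backward induction over the core products listed in s, from the terminal
   table VT: the values of the first stage, and the decisions of all stages.
   As n : 'I_N counts the preceding products, the grid points n K / K and below
   are the only ones that can be reached at stage n. *)
Fixpoint backwardC (VT : seq R) (s : seq 'I_(nc A)) :
    comp (seq R * seq (seq (R * nat))) :=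
  if s is n :: s' then
    let* (next, decs) := backwardC VT s' in
    let* rd := roundedC n in
    let* h := step (n * K)%N in
    let* cells := mapC (stageC next rd) (iota 0 h.+1) in
    let* vals := mapC (fun x => ret x.1) cells in
    let* dec := mapC (fun x => ret x.2) cells in
    step (vals, dec :: decs)
  else step (VT, [::]).

(* The core prices along the optimality equations from the grid index k, and
   the terminal grid index *)
Fixpoint retrieveC (decs : seq (seq (R * nat))) (k : nat) :
    comp (seq R * nat) :=
  if decs is d :: decs' then
    let* (p, l) := nthC (0, 0%N) d k in
    let* (ps, kT) := retrieveC decs' l in
    step (p :: ps, kT)
  else step ([::], k).

(* The policy is computed as two lists; they are read off as functions of the
   product index without further computation. *)
Definition discretized_dp : comp (policy A) :=
  let* T1 := part1C in
  let* VT := mapC (fun x => ret x.1) T1 in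
  let* (_, decs) := backwardC VT (enum 'I_(nc A)) in
  let* (ps, kT) := retrieveC decs 0 in
  let* (_, ds) := nthC (0, [::]) T1 kT in
  ret (@Policy R A (fun n => nth 0 ps n)
                   (fun m => (nth (0, 0, false) ds m).1.1)
                   (fun m => (nth (0, 0, false) ds m).1.2)
                   (fun m => (nth (0, 0, false) ds m).2)).

End Algorithm.

Arguments discretized_dp {R} A K.

(* Main.v *)
(** Write [V(g, pi)] for the revenue of [pi] with the total core demand replaced
    by a parameter [g]; it is affine in [g], with slope in [0, M * top_price].
    The algorithm maximizes [V(g', pi)] exactly, where [g'] is the sum of the
    rounded core demands of [pi] and hence within [N / 2K] of the true one: for
    fixed [g] the supportive part is separable up to the budget, which is spent
    on the largest positive gains.  Passing between [g] and [g'] for OPT and for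
    ALG costs at most [M N top_price / K <= vstar * eps].

    Only the defining inequalities of maximizers, sorted lists and nearest grid
    points are used, so ties in [geC] may be broken arbitrarily. *)
Require Import Defs.
From mathcomp Require Import all_boot all_order all_algebra.
From mathcomp Require Import reals mpoly.
From mathcomp Require Import zify ring lra.

Set Implicit Arguments.
Unset Strict Implicit.
Unset Printing Implicit Defensive.

Import Order.TTheory GRing.Theory Num.Theory.
Local Open Scope ring_scope.

(** * Correctness and cost of computations *)

(** Total correctness for nondeterministic runs: some run exists, so the claim is never vacuous, and
    every run, however ties are broken, satisfies [Q] at cost at most [B]. *)
Definition spec (T : Type) (c : Defs.comp T) (Q : T -> Prop) (B : nat) : Prop :=
  (exists a t, c a t) /\ (forall a t, c a t -> Q a /\ (t <= B)%N).

Section Rules.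
Variables T U : Type.
Implicit Types (c : Defs.comp T) (Q : T -> Prop) (B : nat).

Lemma spec_weaken c Q1 Q2 B1 B2 :
  spec c Q1 B1 -> (forall a, Q1 a -> Q2 a) -> (B1 <= B2)%N -> spec c Q2 B2.
Proof.
move=> [run H] Q12 B12; split=> // a t /H [q1 tB]; split; first exact: Q12.
exact: leq_trans tB B12.
Qed.

Lemma spec_le c Q B1 B2 : spec c Q B1 -> (B1 <= B2)%N -> spec c Q B2.
Proof. by move=> H; apply: spec_weaken H _. Qed.

Lemma spec_ret (a : T) Q : Q a -> spec (ret a) Q 0.
Proof. by move=> Qa; split; [exists a, 0%N | move=> b t [-> ->]]. Qed.

Lemma spec_step (a : T) Q : Q a -> spec (step a) Q 1.
Proof. by move=> Qa; split; [exists a, 1%N | move=> b t [-> ->]]. Qed.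

Lemma spec_bind c (f : T -> Defs.comp U) Q (Q' : U -> Prop) B1 B2 :
  spec c Q B1 -> (forall a, Q a -> spec (f a) Q' B2) ->
  spec (bind c f) Q' (B1 + B2).
Proof.
move=> [[a [t cat]] Hc] Hf; split.
  have [Qa _] := Hc _ _ cat; have [[b [t' fbt]] _] := Hf a Qa.
  by exists b, (t + t')%N, a, t, t'.
move=> b _ [x [t1 [t2 [/Hc[Qx t1B] fxb ->]]]].
have [_ /(_ _ _ fxb) [Qb t2B]] := Hf x Qx.
by split=> //; apply: leq_add.
Qed.

Lemma spec_bind_step (a : T) (f : T -> Defs.comp U) (Q' : U -> Prop) B :
  spec (f a) Q' B -> spec (bind (step a) f) Q' B.+1.
Proof.
move=> H; rewrite -add1n; apply: (spec_bind (spec_step (erefl a))) => _ /= <-.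
exact: H.
Qed.

End Rules.

Lemma spec_geC (R : realType) (x y : R) :
  spec (geC x y) (fun b => if b then y <= x else x <= y) 1.
Proof.
split; last by move=> b t [H ->].
by case/orP: (le_total y x) => H; [exists true, 1%N | exists false, 1%N].
Qed.

Section ListSpecs.
Variables T U : eqType.

(** Two runs of [f] on the same input may differ, so the results form a function of the input only
    because [s] is duplicate-free. [g0] supplies the values outside [s]. *)
Lemma spec_map_fun (g0 : T -> U) (f : T -> Defs.comp U)
    (Q : T -> U -> Prop) s n B :
    uniq s -> (size s <= n)%N ->
    (forall x, x \in s -> spec (f x) (Q x) B) ->
  spec (mapC f s)
    (fun ys => exists2 g, ys = map g s & forall x, x \in s -> Q x (g x))
    (n * B.+1).+1.
Proof.
elim: s n => [|x s IH] [|n] //= us szs Hf.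
- by apply: spec_step; exists g0.
- by apply: (spec_le (spec_step _)) => //; exists g0.
have /andP[xs {}us] := us.
eapply spec_le.
  apply: (spec_bind (Hf x (mem_head _ _))) => y Qy.
  apply: (spec_bind (IH n us szs _)).
    by move=> z zs; apply: Hf; rewrite inE zs orbT.
  move=> _ [g -> Qg]; apply: spec_step.
  exists (fun z => if z == x then y else g z).
    rewrite eqxx; congr (_ :: _); apply/eq_in_map => z zs.
    by case: eqP xs => // <-; rewrite zs.
  move=> z; rewrite inE; case: eqP => [->|_] //=; exact: Qg.
lia.
Qed.

End ListSpecs.

Section ListSpecsDet.
Variables T U : Type.

Lemma spec_map (g : T -> U) (f : T -> Defs.comp U) s n B :
    (size s <= n)%N -> (forall x, spec (f x) (eq (g x)) B) ->
  spec (mapC f s) (eq (map g s)) (n * B.+1).+1.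
Proof.
move=> szs Hf; elim: s n szs => [|x s IH] [|n] //= szs.
- exact: spec_step.
- exact: (spec_le (spec_step _)).
eapply spec_le.
  apply: (spec_bind (Hf x)) => _ <-.
  by apply: (spec_bind (IH n szs)) => _ <-; apply: spec_step.
lia.
Qed.

Lemma spec_filter (p : pred T) s n :
  (size s <= n)%N ->
  spec (filterC (fun x => step (p x)) s) (eq (filter p s)) (n * 2).+1.
Proof.
elim: s n => [|x s IH] [|n] //= szs.
- exact: spec_step.
- exact: (spec_le (spec_step _)).
eapply spec_le.
  apply: spec_bind_step.
  by apply: (spec_bind (IH n szs)) => _ <-; apply: spec_step.
lia.
Qed.

Lemma spec_cat (s1 s2 : seq T) : spec (catC s1 s2) (eq (s1 ++ s2)) (size s1).+1.
Proof.
elim: s1 => [|x s1 IH] /=; first exact: spec_step.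
eapply spec_le.
  by apply: (spec_bind IH) => _ <-; apply: spec_step.
lia.
Qed.

Lemma spec_flatten (ss : seq (seq T)) n k :
    (size ss <= n)%N -> all (fun s => size s <= k)%N ss ->
  spec (flattenC ss) (eq (flatten ss)) (n * k.+1).+1.
Proof.
elim: ss n => [|s ss IH] [|n] //= szs.
- by move=> _; apply: spec_step.
- by move=> _; apply: (spec_le (spec_step _)).
move=> /andP[sk ssk].
eapply spec_le.
  apply: (spec_bind (IH n szs ssk)) => _ <-; exact: spec_cat.
lia.
Qed.

Lemma spec_nth (x0 : T) s i : spec (nthC x0 s i) (eq (nth x0 s i)) (size s).+1.
Proof.
elim: s i => [|x s IH] [|i] /=; try exact: (spec_le (spec_step _)).
exact: spec_bind_step.
Qed.

End ListSpecsDet.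

Lemma spec_mem (T : eqType) (x : T) s :
  spec (memC x s) (eq (x \in s)) (size s).+1.
Proof.
elim: s => [|y s IH] /=; first exact: spec_step.
apply: spec_bind_step; rewrite inE; case: (x == y) => //=.
exact: (spec_le (spec_ret _)).
Qed.

(** * Argmax, insertion sort and greedy selection *)

Section KeyedSpecs.
Variables (R : realType) (T : eqType).
Implicit Types (x : R * T) (s : seq (R * T)).

Lemma spec_sum s : spec (sumC s) (eq (\sum_(x <- s) x.1)) (size s).+1.
Proof.
elim: s => [|x s IH] /=; first by rewrite big_nil; apply: spec_step.
rewrite big_cons; eapply spec_le.
  by apply: (spec_bind IH) => _ <-; apply: spec_step.
lia.
Qed.

(** The head carries the best entry so far; a discarded entry is dominated by the one kept, hence by
    the final result. *)
Lemma spec_argmax (d : T) s n :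
    s != [::] -> (size s <= n)%N ->
  spec (argmaxC d s) (fun r => r \in s /\ forall x, x \in s -> x.1 <= r.1) n.
Proof.
case: s => [|x s] //= _; elim: s x n => [|y s IH] x [|n] //= szs.
  apply: (spec_le (spec_step _)) => //; rewrite mem_head; split=> // z.
  by rewrite inE => /eqP ->.
rewrite -add1n; apply: (spec_bind (spec_geC _ _)) => -[] yx.
  apply: spec_weaken (IH y n szs) _ _ => // r [rys rmax]; split.
    by rewrite inE rys orbT.
  move=> z; rewrite inE => /predU1P[->|/rmax//].
  by apply: le_trans yx (rmax _ _); rewrite mem_head.
apply: spec_weaken (IH x n szs) _ _ => // r [rxs rmax]; split.
  by move: rxs; rewrite !inE => /orP[] ->; rewrite ?orbT.
move=> z; rewrite !inE => /or3P[/eqP->|/eqP->|zs].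
- by apply: rmax; rewrite mem_head.
- by apply: le_trans yx (rmax _ _); rewrite mem_head.
- by apply: rmax; rewrite inE zs orbT.
Qed.

Definition descending s := sorted (fun x y => y.1 <= x.1) s.

Lemma descending_trans : transitive (fun x y : R * T => y.1 <= x.1).
Proof. by move=> y x z /= yx zy; apply: le_trans zy yx. Qed.

Lemma spec_insert x s :
    descending s ->
  spec (insertC x s) (fun r => perm_eq r (x :: s) /\ descending r)
    (size s * 2).+1.
Proof.
elim: s => [|y s IH] /= ds; first exact: spec_step.
have ds' : descending s by case: (s) ds => //= z s0 /andP[].
rewrite (_ : _.+1 = 1 + (size s * 2).+2)%N; last lia.
apply: (spec_bind (spec_geC _ _)) => -[] xy.
  apply: (spec_le (spec_step _)); last by [].
  by rewrite perm_refl /descending /= xy.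
rewrite -addn1; apply: (spec_bind (IH ds')) => r [pr dr].
apply: spec_step; split.
  apply: (@perm_trans _ (y :: x :: s)); first by rewrite perm_cons.
  by rewrite (perm_catCA [:: y] [:: x] s).
rewrite /descending /= path_sortedE; last exact: descending_trans.
apply/andP; split; last exact: dr.
rewrite (perm_all _ pr) /= xy /=.
by move: ds; rewrite path_sortedE; [case/andP | exact: descending_trans].
Qed.

Lemma spec_sort s n :
    (size s <= n)%N ->
  spec (sortC s) (fun r => perm_eq r s /\ descending r) (n * (n * 2).+1).+1.
Proof.
move=> szs; apply: (@spec_le _ _ _ (size s * (n * 2).+1).+1); last first.
  by rewrite ltnS leq_mul2r szs orbT.
elim: s szs => [|x s IH] szs; first exact: spec_step.
eapply spec_le.
  apply: (spec_bind (IH (ltnW szs))) => r [pr dr].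
  apply: (@spec_weaken _ _ _ _ _ (n * 2).+1 (spec_insert x dr)).
    move=> r' [pr' dr']; split=> //.
    by apply: perm_trans pr' _; rewrite perm_cons.
  by move: szs; rewrite (perm_size pr) /=; lia.
rewrite /=; lia.
Qed.

Lemma spec_select k s :
  spec (selectC k s) (eq [seq x.2 | x <- take k s & 0 < x.1]) (size s * 2).+1.
Proof.
elim: s k => [|x s IH] [|k] /=; try exact: (spec_le (spec_step _)).
eapply spec_le.
  apply: spec_bind_step; apply: (spec_bind (IH k)) => _ <-.
  by apply: spec_step; case: ifP.
lia.
Qed.

Lemma sum_take_pos_cons x s k :
  \sum_(y <- take k.+1 (x :: s) | 0 < y.1) y.1
  = Num.max 0 x.1 + \sum_(y <- take k s | 0 < y.1) y.1.
Proof.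
by rewrite /= big_cons; case: ltP => H; rewrite ?add0r.
Qed.

(** One more entry of [s] adds at most the positive part of [x], because [x] dominates all of
    [s]. *)
Lemma sum_take_posS x s k :
    all (fun y => y.1 <= x.1) s ->
  \sum_(y <- take k.+1 s | 0 < y.1) y.1
  <= Num.max 0 x.1 + \sum_(y <- take k s | 0 < y.1) y.1.
Proof.
elim: s k => [|z s IH] k; first by rewrite !big_nil addr0 le_max lexx.
move=> /andP[zx sx]; rewrite sum_take_pos_cons; case: k => [|k].
  rewrite !take0 !big_nil !addr0.
  by rewrite ge_max !le_max lexx zx /= orbT.
rewrite sum_take_pos_cons addrCA lerD2l; exact: IH.
Qed.

(** Induction on the sorted list. If [c] takes the head, both sides spend one unit of budget on it;
    if not, [sum_take_posS] shows that a unit spent on the head is worth at least as much as one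
    spent further down. *)
Lemma greedy_selection s k (c : pred (R * T)) :
    descending s -> (count c s <= k)%N ->
  \sum_(x <- s | c x) x.1 <= \sum_(x <- take k s | 0 < x.1) x.1.
Proof.
elim: s k => [|x s IH] k; first by rewrite !big_nil.
rewrite /descending /= path_sortedE; last exact: descending_trans.
move=> /andP[sx ds]; rewrite big_cons; case: ifP => cx /= szc.
  case: k szc => // k szc; rewrite sum_take_pos_cons.
  by rewrite lerD ?IH // le_max lexx orbT.
case: k szc => [|k] szc; first by have := IH 0%N ds szc; rewrite take0.
by rewrite sum_take_pos_cons (le_trans (IH _ ds szc)) // sum_take_posS.
Qed.

End KeyedSpecs.

(** * Supportive products *)

(** Carries the greedy bound from list entries to sets of products: the entries are the pairs
    [(d m, m)], exactly one per product. *)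
Lemma selection_optimal (R : realType) (T : finType) (d : T -> R) k s :
    perm_eq s [seq (d m, m) | m <- enum T] -> descending s ->
  let sel := [seq x.2 | x <- take k s & 0 < x.1] in
  [/\ uniq sel, (size sel <= k)%N
    & forall c : pred T, (#|c| <= k)%N ->
      \sum_(m | c m) d m <= \sum_(m | m \in sel) d m].
Proof.
move=> ps ds sel.
have sd x : x \in s -> x.1 = d x.2 by rewrite (perm_mem ps) => /mapP[m _ ->].
have p2 : perm_eq [seq x.2 | x <- s] (enum T).
  by apply: (perm_trans (perm_map snd ps)); rewrite -map_comp map_id.
have usel : uniq sel.
  have : uniq [seq x.2 | x <- s] by rewrite (perm_uniq p2) enum_uniq.
  apply: subseq_uniq; apply: map_subseq.
  exact: subseq_trans (filter_subseq _ _) (take_subseq _ _).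
split=> //.
  rewrite size_map (leq_trans (size_subseq (filter_subseq _ _))) //.
  by rewrite size_take_min geq_minl.
move=> c ck; have := @greedy_selection _ _ s k (fun x => c x.2) ds.
have sumE (P : pred (R * T)) : \sum_(x <- s | P x) x.1
    = \sum_(m | P (d m, m)) d m.
  by rewrite (perm_big _ ps) big_map big_enum_cond /=.
have -> : \sum_(m | m \in sel) d m = \sum_(x <- take k s | 0 < x.1) x.1.
  rewrite -big_uniq // big_map big_filter big_seq_cond [RHS]big_seq_cond.
  by apply: eq_bigr => x /andP[/mem_take /sd ->].
rewrite sumE; apply; apply: leq_trans ck.
rewrite (permP ps) count_map cardE -size_filter.
apply: uniq_leq_size; first by rewrite filter_uniq ?enum_uniq.
by move=> m; rewrite mem_filter !mem_enum andbT.
Qed.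

Lemma size_flatten_le (T : Type) (ss : seq (seq T)) k :
  all (fun s => size s <= k)%N ss -> (size (flatten ss) <= size ss * k)%N.
Proof.
elim: ss => //= s ss IH /andP[sk /IH]; rewrite size_cat; lia.
Qed.

Section SupportiveDecisions.
Variables (R : realType) (A : instance R).
Implicit Types (m : 'I_(ns A)) (g p : R) (x : R * R * bool).
Implicit Types D : 'I_(ns A) -> R * R * bool.

(** The triple [x] is (p, p', I): price, discount price, and whether the discount is offered. *)
Definition addon_revenue m x : R :=
  if x.2 then beta' m x.1.2 * x.1.2 else beta m x.1.1 * x.1.1.

Definition support_revenue m g x : R :=
  alphas m x.1.1 * x.1.1 + g * addon_revenue m x.

Definition admissible D : Prop :=
  [/\ forall m, (D m).1.1 \in Os A,
      forall m, (D m).1.2 \in Oa A,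
      (\sum_m (D m).2 <= Defs.space A)%N
    & forall m, (D m).2 -> (D m).1.2 < (D m).1.1].

(** The 0 is a placeholder: with flag [false] the discount price does not enter the revenue. *)
Definition is_r m g (r : R * R) : Prop :=
  [/\ r.2 \in Os A, r.1 = support_revenue m g (r.2, 0, false)
    & forall p, p \in Os A -> support_revenue m g (p, 0, false) <= r.1].

Definition is_r' m g (r : R * (R * R)) : Prop :=
  [/\ [/\ r.2.1 \in Os A, r.2.2 \in Oa A & r.2.2 < r.2.1],
      r.1 = support_revenue m g (r.2, true)
    & forall p p', p \in Os A -> p' \in Oa A -> p' < p ->
        support_revenue m g (p, p', true) <= r.1].

Definition idle_price p : R := nth (nth 0 (Oa A) 0) [seq p' <- Oa A | p' < p] 0.

Lemma idle_price_mem p : Oa A != [::] -> idle_price p \in Oa A.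
Proof.
move=> Oa0; rewrite /idle_price.
case E: [seq p' <- Oa A | p' < p] => [|y s] /=.
  by rewrite mem_nth // lt0n size_eq0.
by have : y \in [seq p' <- Oa A | p' < p];
  [rewrite E mem_head | rewrite mem_filter => /andP[]].
Qed.

Lemma idle_price_lt p :
  (exists2 p', p' \in Oa A & p' < p) -> idle_price p < p.
Proof.
move=> [p' pO lp]; rewrite /idle_price.
case E: [seq p' <- Oa A | p' < p] => [|y s] /=.
  by have : p' \in [seq p' <- Oa A | p' < p];
    [rewrite mem_filter lp | rewrite E].
by have : y \in [seq p' <- Oa A | p' < p];
  [rewrite E mem_head | rewrite mem_filter => /andP[]].
Qed.

(* All costs are bounded by polynomials in a common bound [L] on the sizes. *)
Variable L : nat.
Hypotheses (ns_le : (ns A <= L)%N) (Os_le : (size (Os A) <= L)%N).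
Hypotheses (Oa_le : (size (Oa A) <= L)%N).
(** Keeps the candidate lists of both maxima nonempty, so that argmax never returns its dummy. In
    the theorem the prices of [OPT] provide the witnesses. *)
Hypothesis discountable : exists p p', [/\ p \in Os A, p' \in Oa A & p' < p].

Lemma spec_belowC p :
  spec (belowC A p) (eq [seq p' <- Oa A | p' < p]) (L * 2).+1.
Proof. exact: (spec_filter (fun p' => p' < p)). Qed.

Lemma spec_rC m g : spec (rC m g) (is_r m g) (L * 8).+1.
Proof.
rewrite (_ : _.+1 = (L * 7).+1 + L)%N; last lia.
pose f p := (support_revenue m g (p, 0, false), p).
apply: (spec_bind (spec_map (g := f) Os_le _)) => [p|_ <-].
  by do 6 apply: spec_bind_step; apply: spec_ret.
have [p [_ [pO _ _]]] := discountable.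
apply: (spec_weaken (spec_argmax _ _ _) _ (leqnn L)).
- by case: (Os A) pO.
- by rewrite size_map.
move=> r [/mapP[q qO ->] rmax]; split=> // q' q'O.
by have := rmax (f q') (map_f _ q'O).
Qed.

(** The quadratic coefficient 11 is 9 for filtering and evaluating the pairs, 1 for flattening and 1
    for the maximum. *)
Lemma spec_r'C m g : spec (r'C m g) (is_r' m g) (L * L * 11 + L * 4 + 2).
Proof.
pose f p p' := (support_revenue m g (p, p', true), (p, p')).
pose below p := [seq p' <- Oa A | p' < p].
have below_le p : (size (below p) <= L)%N.
  exact: leq_trans (size_subseq (filter_subseq _ _)) Oa_le.
have sz_le : all (fun s => size s <= L)%N [seq map (f p) (below p) | p <- Os A].
  by rewrite all_map; apply/allP => p _ /=; rewrite size_map.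
eapply spec_le.
  apply: (spec_bind (spec_map (g := fun p => map (f p) (below p)) Os_le _)).
    move=> p; apply: (spec_bind (spec_belowC p)) => _ <-.
    apply: (spec_map (g := f p) (below_le p)) => p'.
    by do 6 apply: spec_bind_step; apply: spec_ret.
  move=> _ <-; apply: (spec_bind (spec_flatten _ sz_le)) => [|_ <-].
    by rewrite size_map; exact: Os_le.
  apply: (spec_weaken (spec_argmax (n := (L * L)%N) _ _ _) _ (leqnn _)).
  - have [p [p' [pO p'O lp]]] := discountable.
    suff : f p p' \in flatten [seq map (f p) (below p) | p <- Os A].
      by case: flatten.
    by apply/allpairsPdep; exists p, p'; rewrite mem_filter lp.
  - rewrite (leq_trans (size_flatten_le sz_le)) // size_map.
    by rewrite leq_mul2r Os_le orbT.
  move=> r [/allpairsPdep [p [p' [pO]]]].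
  rewrite mem_filter => /andP[lp p'O] -> rmax; split=> // q q' qO q'O lq.
  have /rmax // : f q q' \in flatten [seq map (f p) (below p) | p <- Os A].
  by apply/allpairsPdep; exists q, q'; rewrite mem_filter lq.
lia.
Qed.

Lemma spec_idle_priceC p :
  spec (idle_priceC A p) (eq (idle_price p)) (L * 4 + 3).
Proof.
rewrite (_ : _ + _ = (L * 2).+1 + (L.+1 + L.+1))%N; last lia.
apply: (spec_bind (spec_belowC p)) => _ <-.
apply: (spec_bind (spec_le (spec_nth _ _ _) _)) => [|_ <-]; first by [].
apply: (spec_le (spec_nth _ _ _)); rewrite ltnS.
exact: leq_trans (size_subseq (filter_subseq _ _)) Oa_le.
Qed.

Definition supportive_decision (sel : seq 'I_(ns A))
    (y : R * ('I_(ns A) * (R * R) * (R * (R * R)))) : R * (R * R * bool) :=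
  let: (d, (m, r, r')) := y in
  if m \in sel then (r.1 + d, (r'.2, true))
  else (r.1, (r.2, idle_price r.2, false)).

(** The second clause does not concern revenue: it later upgrades the output from implementable to
    feasible. *)
Definition supportive_optimum g (v : R) D : Prop :=
  [/\ admissible D,
      forall m, (exists2 p', p' \in Oa A & p' < (D m).1.1) ->
        (D m).1.2 < (D m).1.1,
      v = \sum_m support_revenue m g (D m)
    & forall D', admissible D' -> \sum_m support_revenue m g (D' m) <= v].

(** For fixed [g] the best revenue is the sum of the [r m] plus the gains [d m] of the offered
    products. Products interact only through the budget, and the hypothesis on [sel] settles which
    of them to offer. *)
Lemma supportive_optimumP g r r' sel
    (d := fun m => (r' m).1 - (r m).1)
    (y := fun m => supportive_decision sel (d m, (m, r m, r' m))) :
    (forall m, is_r m g (r m)) -> (forall m, is_r' m g (r' m)) ->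
    uniq sel -> (size sel <= Defs.space A)%N ->
    (forall c : pred 'I_(ns A), (#|c| <= Defs.space A)%N ->
      \sum_(m | c m) d m <= \sum_(m | m \in sel) d m) ->
  supportive_optimum g (\sum_m (y m).1) (fun m => (y m).2).
Proof.
move=> Hr Hr' usel szsel opt.
have Oa0 : Oa A != [::].
  by have [p [p' [_ p'O _]]] := discountable; case: (Oa A) p'O.
have ysel m : (y m).2.2 = (m \in sel) by rewrite /y /=; case: ifP.
split.
- split.
  + move=> m; rewrite /y /=.
    by case: ifP => _ /=; [case: (Hr' m) => -[] | case: (Hr m)].
  + move=> m; rewrite /y /=; case: ifP => _ /=; first by case: (Hr' m) => -[].
    exact: idle_price_mem.
  + rewrite (eq_bigr (fun m => (m \in sel : nat))); last first.
      by move=> m _; rewrite ysel.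
    apply: leq_trans szsel; rewrite -(card_uniqP usel) -sum1_card.
    by rewrite [X in (_ <= X)%N]big_mkcond leq_sum.
  + by move=> m; rewrite ysel /y /= => -> /=; case: (Hr' m) => -[].
- move=> m; rewrite /y /=; case: ifP => _ /= H; first by case: (Hr' m) => -[].
  exact: idle_price_lt.
- apply: eq_bigr => m _; rewrite /y /d /=; case: ifP => _ /=.
    by case: (Hr' m) => _ <- _; rewrite addrC subrK.
  by case: (Hr m) => _ ->.
move=> D [DO DO' Dsp Dlt].
have -> : \sum_m (y m).1 = \sum_m (r m).1 + \sum_(m | m \in sel) d m.
  rewrite [X in _ + X]big_mkcond -big_split; apply: eq_bigr => m _ /=.
  by rewrite /y /=; case: ifP => _ //=; rewrite addr0.
(* The intermediate term offers the same products as the competitor [D]: [opt] compares its gains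
   with those of [sel], and [r], [r'] bound [D] product by product. *)
apply: (@le_trans _ _ (\sum_m (r m).1 + \sum_(m | (D m).2) d m)); last first.
  rewrite lerD2l; apply: opt; apply: leq_trans Dsp.
  by rewrite -sum1_card big_mkcond leq_sum.
rewrite [X in _ + X]big_mkcond -big_split; apply: ler_sum => m _ /=.
have [_ _ rmax] := Hr m; have [_ _ r'max] := Hr' m.
have := Dlt m; have := DO m; have := DO' m.
case: (D m) => [[p p'] []] /= p'O pO lt.
  by rewrite /d addrC subrK r'max // lt.
rewrite addr0; exact: rmax.
Qed.

Variable K : nat.

Lemma spec_supportiveC k :
  spec (supportiveC A K k)
    (fun y => exists2 D, y.2 = [seq D m | m <- enum 'I_(ns A)]
       & supportive_optimum (k%:R / K%:R) y.1 D)
    (L * L * L * 11 + L * L * 20 + L * 30 + 20).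
Proof.
set g := k%:R / K%:R; set enumM := enum _.
have szE : (size enumM <= L)%N by rewrite size_enum_ord.
eapply spec_le.
  apply: spec_bind_step.
  (* Maximizers depend on tie-breaking, so only their defining properties are kept; [r] and [r'] are
     then read back from the run as functions of the product. *)
  pose Q m (y : R * ('I_(ns A) * (R * R) * (R * (R * R)))) := exists r r',
    [/\ y = (r'.1 - r.1, (m, r, r')), is_r m g r & is_r' m g r'].
  apply: (spec_bind (spec_map_fun (Q := Q)
    (fun m => (0, (m, (0, 0), (0, (0, 0))))) _ szE _)).
  - exact: enum_uniq.
  - move=> m _; apply: (spec_bind (spec_rC m g)) => r Hr.
    apply: (spec_bind (spec_r'C m g)) => r' Hr'.
    by apply: spec_bind_step; apply: spec_ret; exists r, r'.
  move=> _ [y -> Hy].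
  pose r m := (y m).2.1.2; pose r' m := (y m).2.2.
  pose d m := (r' m).1 - (r m).1.
  have {Hy} [Ey Hr Hr'] : [/\ forall m, y m = (d m, (m, r m, r' m)),
      forall m, is_r m g (r m) & forall m, is_r' m g (r' m)].
    rewrite /d /r /r'; split=> m; have [] := Hy m; rewrite ?mem_enum //;
      by move=> ? [? [-> ]].
  apply: (spec_bind (spec_map (n := L) (B := 0)
    (g := fun z => (z.1, z.2.1.1)) _ _)) => [||_ <-].
  - by rewrite size_map.
  - by move=> [? [[? ?] ?]]; apply: spec_ret.
  rewrite -map_comp (eq_map (g := fun m => (d m, m))); last first.
    by move=> m /=; rewrite Ey.
  apply: (spec_bind (spec_sort _)) => [|s [ps ds]].
    by rewrite size_map; exact: szE.
  have [usel szsel opt] := selection_optimal (Defs.space A) ps ds.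
  apply: (spec_bind (spec_le (spec_select _ _)
    (_ : _ <= (L * 2).+1)%N)) => [|_ <-].
    by rewrite (perm_size ps) size_map ltnS leq_mul2r szE.
  set sel := map _ _ in usel szsel opt *.
  have selL : (size sel <= L)%N.
    rewrite -(card_uniqP usel); apply: leq_trans (max_card _) _.
    by rewrite card_ord.
  apply: (spec_bind (spec_map (n := L) (B := (L * 5 + 4)%N)
    (g := supportive_decision sel) _ _)) => [||_ <-].
  - by rewrite size_map.
  - move=> [d0 [[m r0] r0']].
    rewrite (_ : _ + _ = L.+1 + (L * 4 + 3))%N; last lia.
    apply: (spec_bind (spec_le (spec_mem _ _) _)) => [//|_ <-].
    rewrite /supportive_decision; case: ifP => _.
      apply: (@spec_le _ _ _ 1); last by lia.
      by apply: spec_bind_step; apply: spec_ret.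
    apply: (@spec_le _ _ _ (L * 4 + 3 + 0)); last lia.
    by apply: (spec_bind (spec_idle_priceC r0.2)) => _ <-; apply: spec_ret.
  rewrite -map_comp.
  apply: (spec_bind (spec_le (spec_sum _) (_ : _ <= L.+1)%N)) => [|_ <-].
    by rewrite size_map ltnS.
  apply: (spec_bind (spec_map (n := L) (B := 0) (g := snd) _ _)) => [||_ <-].
  - by rewrite size_map.
  - by move=> x; apply: spec_ret.
  apply: spec_ret; rewrite -map_comp.
  pose D m := (supportive_decision sel (d m, (m, r m, r' m))).2.
  exists D.
    by apply: eq_map => m; rewrite /= Ey.
  rewrite big_map big_enum /=.
  have := supportive_optimumP Hr Hr' usel szsel opt.
  congr (supportive_optimum _ _ _); apply: eq_bigr => m _.
  by rewrite Ey.
nia.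
Qed.

End SupportiveDecisions.

(** * Rounding and backward induction *)

Section CoreStages.
Variables (R : realType) (A : instance R) (K L : nat).
Hypotheses (K_gt0 : (0 < K)%N) (K_le : (K <= L)%N) (nc_le : (nc A <= L)%N).
Hypothesis Oc_le : (size (Oc A) <= L)%N.
Hypothesis Oc_neq0 : Oc A != [::].

(** [n] counts the rounded terms: each contributes an error of at most half a grid step, 1/(2K). *)
Definition grid_near n (a : R) j : Prop :=
  `|a - j%:R / K%:R| <= n%:R / (K%:R * 2).

Lemma grid_nearD n1 n2 a1 a2 j1 j2 :
  grid_near n1 a1 j1 -> grid_near n2 a2 j2 ->
  grid_near (n1 + n2) (a1 + a2) (j1 + j2).
Proof.
rewrite /grid_near => H1 H2; rewrite !natrD !mulrDl opprD addrACA.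
exact: le_trans (ler_normD _ _) (lerD H1 H2).
Qed.

(** The witness is the floor of aK, or its successor when the fractional part exceeds 1/2. *)
Lemma grid_near_exists (a : R) :
  0 <= a <= 1 -> exists2 j, (j <= K)%N & grid_near 1 a j.
Proof.
move=> /andP[a0 a1]; have K0 : 0 < K%:R :> R by rewrite ltr0n.
have t0 : 0 <= a * K%:R by rewrite mulr_ge0 // ltW.
have tK : a * K%:R <= K%:R by rewrite ler_piMl // ltW.
have nearP j : `|a * K%:R - j%:R| <= 1 / 2 -> grid_near 1 a j.
  move=> H; rewrite /grid_near.
  have -> : a - j%:R / K%:R = (a * K%:R - j%:R) / K%:R.
    by rewrite mulrBl mulfK // gt_eqF.
  rewrite normrM normfV (gtr0_norm K0).
  have -> : 1%:R / (K%:R * 2) = 1 / 2 / K%:R :> R by rewrite invfM mulrA mulrAC.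
  by apply: ler_wpM2r => //; rewrite invr_ge0 ltW.
have /andP[] := truncn_itv t0; set n := Num.truncn _ => n_le lt_n.
have [H|H] := leP (a * K%:R - n%:R) (1 / 2).
  exists n; first by rewrite -(ler_nat R) (le_trans n_le).
  by apply: nearP; rewrite ger0_norm // subr_ge0.
exists n.+1.
  (* The fractional part is positive, so the floor lies strictly below aK <= K and its successor is
     still at most [K]. *)
  by rewrite -(ltr_nat R); lra.
apply: nearP; rewrite ler0_norm; first by rewrite -natr1; lra.
by rewrite subr_le0 ltW.
Qed.

Lemma spec_roundC (a : R) : 0 <= a <= 1 ->
  spec (roundC K a) (fun j => (j <= K)%N /\ grid_near 1 a j) (L * 5 + 6).
Proof.
move=> /grid_near_exists [j0 j0K near0].
pose f j : R * nat := (- `|a - j%:R / K%:R|, j).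
have szI : (size (iota 0 K.+1) <= L.+1)%N by rewrite size_iota ltnS.
eapply spec_le.
  apply: (spec_bind (spec_map (g := f) szI _)) => [j|_ <-].
    by do 3 apply: spec_bind_step; apply: spec_ret.
  apply: (spec_bind (spec_argmax (n := L.+1) _ _ _)) => //.
    by rewrite size_map.
  move=> _ [/mapP[j jI ->] jmax]; apply: spec_ret => /=.
  split; first by move: jI; rewrite mem_iota ltnS.
  apply: le_trans near0; rewrite -lerN2.
  have -> : - `|a - j0%:R / K%:R| = (f j0).1 by [].
  by apply: jmax; apply: map_f; rewrite mem_iota /= ltnS.
lia.
Qed.

Lemma spec_roundedC (n : 'I_(nc A)) :
  spec (roundedC K n)
    (fun rd => exists2 j : R -> nat,
         rd = [seq (p, alphac n p * p, j p) | p <- Oc A]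
       & forall p, p \in Oc A -> (j p <= K)%N /\ grid_near 1 (alphac n p) (j p))
    (L * (L * 5 + 9)).+1.
Proof.
rewrite (_ : (L * 5 + 9)%N = (L * 5 + 8).+1); last by rewrite addnS.
pose Q p (y : R * R * nat) := [/\ y = (p, alphac n p * p, y.2), (y.2 <= K)%N
  & grid_near 1 (alphac n p) y.2].
apply: (spec_weaken (spec_map_fun (Q := Q) (fun=> (0, 0, 0%N)) _ Oc_le _)
  _ (leqnn _)).
- exact: Oc_uniq.
- move=> p pO; rewrite (_ : _ + _ = (L * 5 + 6 + 0).+2)%N; last lia.
  do 2 apply: spec_bind_step.
  apply: (spec_bind (spec_roundC (alphac01 n pO))) => j [jK nj].
  exact: spec_ret.
move=> _ [g -> Hg]; exists (fun p => (g p).2).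
  by apply/eq_in_map => p /Hg [].
by move=> p /Hg [].
Qed.

Lemma spec_stageC (next : seq R) (n : 'I_(nc A)) (j : R -> nat) k W :
    (size next <= W)%N ->
  spec (stageC next [seq (p, alphac n p * p, j p) | p <- Oc A] k)
    (fun y => (exists2 p, p \in Oc A &
        y = (alphac n p * p + nth 0 next (k + j p), (p, (k + j p)%N)))
      /\ forall p, p \in Oc A ->
        alphac n p * p + nth 0 next (k + j p) <= y.1)
    (L * (W + 4) + L).+1.
Proof.
move=> szW.
pose f (z : R * R * nat) : R * (R * nat) :=
  (z.1.2 + nth 0 next (k + z.2), (z.1.1, (k + z.2)%N)).
rewrite -addSn (_ : (W + 4)%N = (W + 3).+1); last by rewrite addnS.
apply: (spec_bind (spec_map (g := f) _ _)) => [||_ <-].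
- by rewrite size_map; exact: Oc_le.
- move=> [[p x] i]; rewrite (_ : W + 3 = (W.+1 + 1).+1)%N; last lia.
  apply: spec_bind_step.
  apply: (spec_bind (spec_le (spec_nth _ _ _) _)) => [|_ <-]; first exact: szW.
  by apply: spec_bind_step; apply: spec_ret.
rewrite -map_comp; set s := map _ _.
apply: (spec_weaken (spec_argmax (s := s) _ _ _) _ (leqnn L)).
- by rewrite -size_eq0 size_map size_eq0.
- by rewrite size_map.
move=> _ [/mapP[p pO ->] rmax]; split; first by exists p.
by move=> q qO; apply: (rmax (_, _)); apply: (map_f (f \o _) qO).
Qed.

(* The rounding at ties, and hence the terminal index [k + j], may vary from run
   to run; only the accumulated drift of half a grid step per product counts. *)
Definition stage_optimal (f : nat -> R) (s : seq 'I_(nc A)) k (v : R) : Prop :=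
  forall P : 'I_(nc A) -> R, (forall n, P n \in Oc A) ->
  exists j, [/\ (j <= size s * K)%N,
    grid_near (size s) (\sum_(n <- s) alphac n (P n)) j
    & \sum_(n <- s) alphac n (P n) * P n + f (k + j)%N <= v].

(** [y] pairs the retrieved prices with the terminal index; [v] is exactly what these prices earn
    when the terminal table is read there. *)
Definition stage_attained (f : nat -> R) (s : seq 'I_(nc A)) k (v : R)
    (y : seq R * nat) : Prop :=
  [/\ size y.1 = size s, all (mem (Oc A)) y.1
    & exists j, [/\ y.2 = (k + j)%N, (j <= size s * K)%N,
        grid_near (size s) (\sum_(x <- zip s y.1) alphac x.1 x.2) j
        & v = \sum_(x <- zip s y.1) alphac x.1 x.2 * x.2 + f (k + j)%N]].

(** The decision tables are constrained only through what retrieval from them yields. After [i]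
    products the reachable indices are 0 to [i * K]. *)
Definition backward_correct (f : nat -> R) i s
    (y : seq R * seq (seq (R * nat))) : Prop :=
  size y.1 = (i * K).+1 /\
  forall k, (k <= i * K)%N ->
    stage_optimal f s k (nth 0 y.1 k) /\
    spec (retrieveC y.2 k) (stage_attained f s k (nth 0 y.1 k))
      (size s * (L * L + 3)).+1.

(** In order: rounding, the table height, the table cells, the two projections, and the final
    pairing. *)
Definition stage_cost : nat :=
  (L * (L * 5 + 9)).+1 + 1 +
  ((L * L).+1 * (L * ((L * L).+1 + 4) + L).+2).+1 + (L * L + 2) * 2 + 1.

(** Induction on the remaining products [s], which are those numbered from [i] on. Rounding errors
    along a path add up by [grid_nearD]. *)
Lemma spec_backwardC VT i s :
    size VT = (nc A * K).+1 ->
    [seq val n | n <- s] = iota i (size s) -> (i + size s = nc A)%N ->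
  spec (backwardC K VT s) (backward_correct (nth 0 VT) i s)
    (size s * stage_cost).+1.
Proof.
move=> szVT; elim: s i => [|n s IH] i /=.
  move=> _; rewrite addn0 => ->; apply: spec_step; split=> //= k _.
  split; last first.
    apply: spec_step; split=> //; exists 0%N; split=> //=.
    - by rewrite addn0.
    - by rewrite /grid_near big_nil !mul0r subr0 normr0.
    - by rewrite big_nil add0r addn0.
  move=> P _; exists 0%N; split=> //=.
    by rewrite /grid_near big_nil !mul0r subr0 normr0.
  by rewrite big_nil add0r addn0.
move=> [ni vs] iN.
have iL : (i <= L)%N by lia.
have iKL : (i * K <= L * L)%N by apply: leq_mul.
have iKL' : (i.+1 * K <= L * L)%N by apply: leq_mul => //; lia.
apply: (@spec_le _ _ _ ((size s * stage_cost).+1 + stage_cost)); last first.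
  by rewrite mulSn addSn ltnS addnC.
apply: (spec_bind (IH i.+1 vs _)); first by rewrite addSnnS.
move=> [next decs] [/= szn next_ok].
rewrite /stage_cost.
rewrite (_ : forall a b c, (a + 1 + b + (c + 2) * 2 + 1 =
  a + (b + (c.+2 + (c.+2 + 1))).+1)%N); last by move=> *; lia.
apply: (spec_bind (spec_roundedC n)) => _ [j -> Hj].
apply: spec_bind_step; rewrite ni.
pose Q k (y : R * (R * nat)) := (exists2 p, p \in Oc A &
        y = (alphac n p * p + nth 0 next (k + j p), (p, (k + j p)%N)))
      /\ forall p, p \in Oc A ->
        alphac n p * p + nth 0 next (k + j p) <= y.1.
have szI : (size (iota 0 (i * K).+1) <= (L * L).+1)%N by rewrite size_iota ltnS.
apply: (spec_bind (spec_map_fun (Q := Q) (fun=> (0, (0, 0%N))) _ szI _)).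
- exact: iota_uniq.
- by move=> k _; apply: spec_stageC; rewrite szn ltnS.
move=> _ [g -> Hg].
have {}Hg k : (k <= i * K)%N -> Q k (g k).
  by move=> kiK; apply: Hg; rewrite mem_iota.
have spec_proj (T : Type) (h : R * (R * nat) -> T) :
    spec (mapC (fun x => ret (h x)) [seq g k | k <- iota 0 (i * K).+1])
      (eq (mkseq (h \o g) (i * K).+1)) (L * L).+2.
  rewrite -[(L * L).+1]muln1 /mkseq (map_comp h).
    apply: (spec_map (g := h) (B := 0)).
    by rewrite size_map.
  by move=> x; apply: spec_ret.
apply: (spec_bind (spec_proj _ fst)) => _ <-.
apply: (spec_bind (spec_proj _ snd)) => _ <-.
have [dec Edec] : {dec | dec = mkseq (snd \o g) (i * K).+1} by eexists.
rewrite -Edec.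
apply: spec_step; split=> [|k kiK]; first by rewrite size_mkseq.
rewrite nth_mkseq ?ltnS //=; have [[p pO gk] gmax] := Hg k kiK.
(* A decision moves the index by at most [K], so the lookup stays inside the next table and never
   reads the default 0. *)
have next_k q : q \in Oc A -> (k + j q <= i.+1 * K)%N.
  by move=> /Hj [jK _]; rewrite mulSn addnC leq_add.
split.
  (* The competitor [P] moves to its own grid point, where the inductive bound applies; [gmax] then
     compares its price with the chosen one. *)
  move=> P HP; have [jK nj] := Hj _ (HP n).
  have [/(_ P HP) [l [lK nl vl]] _] := next_ok _ (next_k _ (HP n)).
  exists (j (P n) + l)%N; split.
  - by rewrite mulSn leq_add.
  - by rewrite big_cons; exact: (grid_nearD nj nl).
  - rewrite big_cons; apply: le_trans (gmax _ (HP n)).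
    by rewrite -addrA lerD2l addnA.
have [_ ret_ok] := next_ok _ (next_k _ pO).
apply: (@spec_le _ _ _
  ((L * L).+2 + ((size s * (L * L + 3)).+1 + 1))); last first.
  by rewrite /= mulSn; lia.
apply: (spec_bind (spec_le (spec_nth _ _ _) _)) => [|_ <-].
  by rewrite Edec size_mkseq !ltnS.
rewrite Edec nth_mkseq ?ltnS //= gk /=.
apply: (spec_bind ret_ok) => -[ps kT] [/= szp pOs [l [-> lK nl vl]]].
have [jK nj] := Hj _ pO.
apply: spec_step; split=> /=; rewrite ?szp ?pO //.
exists (j p + l)%N; split.
- by rewrite addnA.
- by rewrite mulSn leq_add.
- by rewrite big_cons; exact: (grid_nearD nj nl).
- by rewrite big_cons vl /= addnA addrA.
Qed.

End CoreStages.

(** * The approximation guarantee *)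

Section Correctness.
Variables (R : realType) (A : instance R).
Implicit Types pi : policy A.

Definition decisions pi (m : 'I_(ns A)) : R * R * bool :=
  (sprice pi m, aprice pi m, chosen pi m).

Definition core_demand pi : R := \sum_n alphac n (price pi n).

Definition core_revenue pi : R := \sum_n alphac n (price pi n) * price pi n.

(* [V(g, pi)]: the revenue with the total core demand replaced by [g]. *)
Definition value_at g pi : R :=
  core_revenue pi + \sum_m support_revenue m g (decisions pi m).

Lemma value_at_affine g pi :
  value_at g pi
  = core_revenue pi + \sum_m alphas m (sprice pi m) * sprice pi m
    + g * \sum_m addon_revenue m (decisions pi m).
Proof. by rewrite mulr_sumr -addrA -big_split. Qed.

Lemma value_atE pi : value pi = value_at (core_demand pi) pi.
Proof.
rewrite value_at_affine /value; congr (_ + _ * _).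
apply: eq_bigr => m _; rewrite /addon_revenue /=.
by case: chosen; rewrite ?subrr ?subr0 !mul0r ?mul1r ?addr0 ?add0r.
Qed.

Lemma value_atB g1 g2 pi :
  value_at g1 pi - value_at g2 pi
  = (g1 - g2) * \sum_m addon_revenue m (decisions pi m).
Proof. rewrite !value_at_affine; ring. Qed.

Lemma le_top_price (p : R) : p \in Oc A ++ Os A -> p <= top_price A.
Proof. by move=> pO; rewrite /top_price; apply: le_bigmax_seq pO _. Qed.

(** [top_price] ranges over core and supportive prices only; a discount price is bounded by it
    through p' < p, which holds wherever the discount is offered. *)
Lemma addon_revenue_bound pi : implementable pi ->
  0 <= \sum_m addon_revenue m (decisions pi m) <= (ns A)%:R * top_price A.
Proof.
move=> [_ HOs HOa _ lt].
have H m : 0 <= addon_revenue m (decisions pi m) <= top_price A.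
  have s_top : sprice pi m <= top_price A.
    by apply: le_top_price; rewrite mem_cat HOs orbT.
  have s0 := Os_ge0 (HOs m); have a0 := Oa_ge0 (HOa m).
  have := lt m; rewrite /addon_revenue /=; case: chosen => [/(_ isT)|_] /=.
    move=> ltm; have /andP[b0 b1] := beta'01 m (HOa m).
    rewrite mulr_ge0 //= (le_trans (ler_piMl _ b1)) //.
    exact: le_trans (ltW ltm) s_top.
  have /andP[b0 b1] := beta01 m (HOs m).
  by rewrite mulr_ge0 //= (le_trans (ler_piMl _ b1)).
rewrite sumr_ge0 => [/=|m _]; last by case/andP: (H m).
apply: (@le_trans _ _ (\sum_(m < ns A) top_price A)).
  by apply: ler_sum => m _; case/andP: (H m).
by rewrite sumr_const card_ord mulr_natl.
Qed.

Lemma feasible_implementable pi : feasible pi -> implementable pi.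
Proof. by move=> [? ? ? ? ?]; split. Qed.

Lemma implementable_admissible pi :
  implementable pi -> admissible (decisions pi).
Proof. by move=> [? ? ? ? ?]; split. Qed.

Variable K : nat.

(** Exact optimality of the dynamic program, stated without its tables: every policy is evaluated at
    a rounded demand within N/(2K) of its true one. *)
Definition near_optimal pi : Prop :=
  exists2 k, grid_near K (nc A) (core_demand pi) k
  & forall pi', implementable pi' ->
    exists2 j, grid_near K (nc A) (core_demand pi') j
    & value_at (j%:R / K%:R) pi' <= value_at (k%:R / K%:R) pi.

(** Passing from the true to the rounded demand of [pi'], and back for [pi], costs [e * B] each
    time, with [B] the slope bound and [e] = N/(2K). *)
Lemma near_optimal_value pi pi' :
    (0 < K)%N -> implementable pi -> implementable pi' -> near_optimal pi ->
  value pi' - value pi <= top_price A * (ns A)%:R * (nc A)%:R / K%:R.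
Proof.
move=> K0 Hpi Hpi' [k nk /(_ _ Hpi') [j nj le_jk]].
set B := (ns A)%:R * top_price A; set e : R := (nc A)%:R / (K%:R * 2).
have K0' : K%:R != 0 :> R by rewrite pnatr_eq0 -lt0n.
have drift pi0 g1 g2 : implementable pi0 -> `|g1 - g2| <= e ->
    value_at g1 pi0 - value_at g2 pi0 <= e * B.
  move=> /addon_revenue_bound /andP[r0 rB] ge; rewrite value_atB.
  rewrite (le_trans (ler_wpM2r r0 (ler_norm _))) //.
  by apply: ler_pM.
have -> : top_price A * (ns A)%:R * (nc A)%:R / K%:R = e * B + e * B.
  by rewrite /e /B; field.
rewrite !value_atE.
have := drift _ _ _ Hpi' nj; rewrite -/(core_demand pi').
have : `|k%:R / K%:R - core_demand pi| <= e by rewrite distrC.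
move=> /(drift _ _ _ Hpi); lra.
Qed.

Variable L : nat.
Hypotheses (nc_le : (nc A <= L)%N) (ns_le : (ns A <= L)%N).
Hypotheses (Oc_le : (size (Oc A) <= L)%N) (Os_le : (size (Os A) <= L)%N).
Hypotheses (Oa_le : (size (Oa A) <= L)%N) (K_le : (K <= L)%N).
Hypotheses (L_gt0 : (0 < L)%N) (K_gt0 : (0 < K)%N).
Hypothesis Oc_neq0 : Oc A != [::].
Hypothesis discountable : exists p p', [/\ p \in Os A, p' \in Oa A & p' < p].

Definition dp_correct pi : Prop :=
  [/\ implementable pi,
      forall m, (exists2 p', p' \in Oa A & p' < sprice pi m) ->
        aprice pi m < sprice pi m
    & near_optimal pi].

Lemma spec_part1C :
  spec (part1C A K)
    (fun T => exists2 v : nat -> R * seq (R * R * bool),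
         T = mkseq v (nc A * K).+1
       & forall k, (k <= nc A * K)%N -> exists2 D,
           (v k).2 = [seq D m | m <- enum 'I_(ns A)]
         & supportive_optimum (k%:R / K%:R) (v k).1 D)
    ((L * L).+1 * (L * L * L * 11 + L * L * 20 + L * 30 + 21)).+2.
Proof.
apply: spec_bind_step; rewrite [(_ + 21)%N]addnS.
apply: (spec_weaken (spec_map_fun (fun=> (0, [::])) _ _
  (fun k _ => spec_supportiveC ns_le Os_le Oa_le discountable K k))
  _ (leqnn _)).
- exact: iota_uniq.
- by rewrite size_iota ltnS leq_mul.
move=> _ [v -> Hv]; exists v => // k kK; apply: Hv.
by rewrite mem_iota ltnS.
Qed.

(** Turns sums over the zipped price list into sums over products, matching how the output policy
    reads its prices. *)
Lemma zip_map_nth (T : Type) (x0 : T) n (s : seq T) : size s = n ->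
  zip (enum 'I_n) s = [seq (i, nth x0 s i) | i : 'I_n <- enum 'I_n].
Proof.
move=> szs; rewrite -{1}(mkseq_nth x0 s) szs /mkseq -val_enum_ord -map_comp.
by elim: (enum _) => //= i t ->.
Qed.

(** Since [L] is positive and all degrees are at most 6, every monomial is at most [L ^ 6]; 220 is
    the sum of the coefficients, that is, the left side at [L] = 1. *)
Lemma dp_cost_le :
  (((L * L).+1 * (L * L * L * 11 + L * L * 20 + L * 30 + 21)).+2
   + ((L * L).+2 + ((L * stage_cost L).+1
     + ((L * (L * L + 3)).+1 + (L * L).+2))) <= 220 * L ^ 6)%N.
Proof.
have pow i : (i <= 6)%N -> (L ^ i <= L ^ 6)%N by move=> i6; rewrite leq_pexp2l.
have := pow 0%N isT; have := pow 1%N isT; have := pow 2 isT.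
have := pow 3 isT; have := pow 4 isT; have := pow 5 isT.
rewrite /stage_cost !expnS expn0 !muln1; nia.
Qed.

Lemma spec_discretized_dp :
  spec (discretized_dp A K) dp_correct (220 * L ^ 6).
Proof.
apply: spec_le dp_cost_le.
apply: (spec_bind spec_part1C) => T1 [v].
set n := nc A => ET1 Hv.
have nKL : (n * K <= L * L)%N by apply: leq_mul.
apply: (spec_bind (spec_le
  (spec_map (n := (L * L).+1) (B := 0) (g := fst) _ _) _)) => [|||_ <-].
- by rewrite ET1 size_mkseq ltnS.
- by move=> x; apply: spec_ret.
- by rewrite muln1.
set VT := map _ _.
have szVT : size VT = (n * K).+1 by rewrite size_map ET1 size_mkseq.
have nthVT k : (k <= n * K)%N -> nth 0 VT k = (v k).1.
  by move=> kK; rewrite (nth_map (0, [::])) ET1 ?size_mkseq // nth_mkseq.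
apply: (spec_bind (spec_le
  (spec_backwardC (i := 0) K_gt0 K_le nc_le Oc_le Oc_neq0 szVT _ _) _)).
- by rewrite size_enum_ord val_enum_ord.
- by rewrite size_enum_ord.
- by rewrite size_enum_ord ltnS leq_mul2r nc_le orbT.
move=> [vals decs] [_ /(_ 0%N isT) /= [opt ret_ok]].
apply: (spec_bind (spec_le ret_ok _)).
  by rewrite size_enum_ord ltnS leq_mul2r nc_le orbT.
move=> [ps kT] [/=]; rewrite size_enum_ord => szps psO [k [-> kK nk vk]].
rewrite add0n in vk *.
rewrite -[(L * L).+2]addn0.
apply: (spec_bind (spec_le (spec_nth _ _ _) _)) => [|_ <-].
  by rewrite ET1 size_mkseq !ltnS.
rewrite ET1 nth_mkseq //.
have [D vD [Dadm Didle vE _]] := Hv k kK.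
case E: (v k) vD vE => [w ds] /= -> vE.
have nthD (m : 'I_(ns A)) :
    nth (0, 0, false) [seq D m | m <- enum 'I_(ns A)] m = D m.
  by rewrite (nth_map m) ?size_enum_ord ?nth_ord_enum.
apply: spec_ret; set pi := Policy _ _ _ _.
have decE m : decisions pi m = D m.
  by rewrite /decisions /pi /= nthD; case: (D m) => [[]].
have implE : implementable pi.
  have [D1 D2 D3 D4] := Dadm; split=> [i|m|m||m] /=; rewrite ?nthD //.
  - by apply: (allP psO); rewrite mem_nth // szps.
  - by under eq_bigr do rewrite nthD.
  - exact: D4.
split=> //; first by move=> m /=; rewrite nthD; exact: Didle.
move: nk vk; rewrite (zip_map_nth 0 szps) !big_map -enumT !big_enum /=.
rewrite nthVT // E /= vE => nk vk; exists k => // pi' Hpi'.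
have [HOc _ _ _ _] := Hpi'.
have [j [jK nj le_j]] := opt _ HOc.
rewrite size_enum_ord !big_enum /= in jK nj le_j.
have -> : value_at (k%:R / K%:R) pi = vals`_0.
  by rewrite vk; congr (_ + _); apply: eq_bigr => m _; rewrite decE.
(* The terminal entry at [j] is the best supportive revenue for demand j/K, so it dominates that of
   [pi']. *)
exists j => //; apply: le_trans le_j; rewrite add0n nthVT // lerD2l.
have [_ _ [_ _ _]] := Hv j jK; apply.
exact: implementable_admissible.
Qed.

End Correctness.

(** * The choice of K and the running-time polynomial *)

Lemma absz_ceil_bounds (R : archiRealFieldType) (x : R) :
  0 < x -> x <= (`|Num.ceil x|%N)%:R <= x + 1.
Proof.
move=> x0; have c0 : 0 <= Num.ceil x.
  by rewrite ceil_ge0 (lt_trans _ x0) // ltrN10.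
rewrite natr_absz ger0_norm // ceil_ge /=.
by have /andP[] := ceil_itv x; rewrite intrD; lra.
Qed.

(** The first five variables of [P] are the sizes, the sixth is 1/eps, and the seventh is the ratio
    of the top price to [vstar], on which [K] depends. *)
Theorem theorem1 (R : realType) :
  exists P : {mpoly R[7]},
  forall (A : instance R) (OPT : policy A) (vstar eps : R),
    (0 < nc A)%N -> (0 < ns A)%N ->
    optimal OPT -> 0 < vstar -> vstar <= value OPT -> 0 < eps ->
    let K := `|Num.ceil (top_price A * (ns A)%:R * (nc A)%:R
                         / (vstar * eps))|%N in
    (exists (ALG : policy A) (t : nat), discretized_dp A K ALG t) /\
    (forall (ALG : policy A) (t : nat), discretized_dp A K ALG t ->
      [/\ implementable ALG,
          (forall p, p \in Os A -> exists2 p', p' \in Oa A & p' < p) ->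
            feasible ALG,
          value OPT - value ALG <= eps * value OPT
        & t%:R <= P.@[fun i : 'I_7 =>
            [:: (nc A)%:R; (ns A)%:R; (size (Oc A))%:R; (size (Os A))%:R;
                (size (Oa A))%:R; eps^-1; top_price A / vstar]`_i]]).
Proof.
pose x k : {mpoly R[7]} := 'X_(inord k).
(* This is 220 L^6 with [K] replaced by its upper bound y + 1, where y is the argument of the
   ceiling. *)
exists (220 *: (x 0%N + x 1%N + x 2%N + x 3%N + x 4%N
                + (x 6%N * x 1%N * x 0%N * x 5%N + 1)) ^+ 6).
move=> A OPT vstar eps N0 M0 [feasO _] v0 vO e0.
set y := _ / (vstar * eps); move=> K.
have [HOc HOs HOa _ lt] := feasO.
(* The first supportive product of [OPT] has 0 <= p' < p, which makes [top_price], and hence [K],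
   positive. *)
have lt0 := lt (Ordinal M0); have pOs := HOs (Ordinal M0).
have pOa := HOa (Ordinal M0).
have top0 : 0 < top_price A.
  apply: lt_le_trans (le_top_price (p := sprice OPT (Ordinal M0)) _).
    exact: le_lt_trans (Oa_ge0 pOa) lt0.
  by rewrite mem_cat pOs orbT.
have y0 : 0 < y by rewrite /y divr_gt0 ?mulr_gt0 ?ltr0n.
have /andP[yK Ky] := absz_ceil_bounds y0; rewrite -/K in yK Ky.
have K0 : (0 < K)%N by rewrite -(ltr_nat R) (lt_le_trans y0).
pose L := (nc A + ns A + size (Oc A) + size (Os A) + size (Oa A) + K)%N.
have [||||||||||run Hrun] := @spec_discretized_dp R A K L.
1-8: rewrite /L; lia.
- by case: (Oc A) (HOc (Ordinal N0)).
- by exists (sprice OPT (Ordinal M0)), (aprice OPT (Ordinal M0)).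
split=> // ALG t /Hrun[[impl idle near] tL]; split=> //.
- move=> below; have [H1 H2 H3 H4 _] := impl; split=> // m.
  by apply: idle; apply: below.
- have implO := feasible_implementable feasO.
  apply: le_trans (near_optimal_value K0 impl implO near) _.
  (* The loss is at most [eps * vstar] because [K] >= y. *)
  apply: (@le_trans _ _ (eps * vstar)); last by rewrite ler_pM2l.
  rewrite ler_pdivrMr ?ltr0n // (_ : _ * K%:R = K%:R * (vstar * eps));
    last by ring.
  by rewrite -ler_pdivrMr ?mulr_gt0.
apply: (@le_trans _ _ (220 * L%:R ^+ 6)).
  by rewrite -natrX -natrM ler_nat.
rewrite mevalZ rmorphXn /= !mevalD !mevalM meval1 /x !mevalXU !inordK //=.
rewrite ler_pM2l ?ltr0n // lerXn2r ?nnegrE ?ler0n //.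
  by rewrite !addr_ge0 ?ler0n ?mulr_ge0 ?invr_ge0 ?ler0n // ltW.
rewrite /L !natrD lerD2l (le_trans Ky) // lerD2r /y invfM.
rewrite le_eqVlt; apply/orP; left; apply/eqP; ring.
Qed.
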